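(* Let $\mathcal{H}$ be a complex Hilbert space, let $A\in\mathbb{B}(\mathcal{H})$ be a positive operator, and let $\mathbb{A}=\begin{bmatrix} A & 0\\ 0 & A\end{bmatrix}$ on $\mathcal{H}\oplus\mathcal{H}$. Let $T, S, X, Y\in\mathbb{B}_{A^{1/2}}(\mathcal{H})$. Then (i) $w_{\mathbb{A}}\left(\begin{bmatrix} T & X \\ 0 & 0 \end{bmatrix}\right) \leq w_{A}(T) +\frac{1}{2}\|X\|_{A}$; (ii) $w_{\mathbb{A}}\left(\begin{bmatrix} 0 & 0 \\ Y & S \end{bmatrix}\right)\leq w_{A}(S) +\frac{1}{2}\|Y\|_{A}$.
   Context: $\mathbb{B}(\mathcal{H})$ is the algebra of bounded linear operators on the complex Hilbert space $\mathcal{H}$. A positive operator $A$ (i.e. $\langle Ax,x\rangle\ge 0$ for all $x$) induces the semi-inner product $\langle x,y\rangle_A=\langle Ax,y\rangle$ and the seminorm $\|x\|_A=\sqrt{\langle x,x\rangle_A}$. $\mathbb{B}_{A^{1/2}}(\mathcal{H})=\{T\in\mathbb{B}(\mathcal{H}): \exists c>0,\ \|Tx\|_A\le c\|x\|_A\ \forall x\in\mathcal{H}\}$. For $T\in\mathbb{B}_{A^{1/2}}(\mathcal{H})$ the $A$-operator seminorm is $\|T\|_A=\sup\{\|Tx\|_A: x\in\mathcal{H},\ \|x\|_A=1\}$ and the $A$-numerical radius is $w_A(T)=\sup\{|\langle Tx,x\rangle_A|: x\in\mathcal{H},\ \|x\|_A=1\}$. The same definitions with $\mathcal{H}\oplus\mathcal{H}$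 and $\mathbb{A}$ in place of $\mathcal{H}$ and $A$ give $\langle\cdot,\cdot\rangle_{\mathbb{A}}$, $\|\cdot\|_{\mathbb{A}}$ and $w_{\mathbb{A}}(\cdot)$, where $\langle x,y\rangle_{\mathbb{A}}=\langle x_1,y_1\rangle_A+\langle x_2,y_2\rangle_A$ for $x=(x_1,x_2)$, $y=(y_1,y_2)$. $2\times2$ block matrices of operators on $\mathcal{H}$ act on $\mathcal{H}\oplus\mathcal{H}$ in the usual way. *)

(* Defs.v *)
From HB Require Import structures.
From mathcomp Require Import all_boot all_order all_algebra.
From mathcomp Require Import all_classical all_reals all_analysis.
From mathcomp Require Import sesquilinear complex lra.

Set Implicit Arguments.
Unset Strict Implicit.
Unset Printing Implicit Defensive.

Import Order.TTheory GRing.Theory Num.Theory.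
Import numFieldNormedType.Exports.

Local Open Scope ring_scope.
Local Open Scope complex_scope.
Local Open Scope classical_set_scope.

(* A complex Hilbert space is a complete normed space over R[i] whose norm
   comes from an inner product. As usual for sesquilinear forms in MathComp, the
   inner product is linear in its first argument and conjugate-linear in the
   second one. *)
HB.mixin Record CompleteNormedModule_isHilbert (R : realType) H
    of CompleteNormedModule R[i] H := {
  inner : {dot H for @Num.conj R[i]} ;
  inner_normE : forall x : H, inner x x = `|x| ^+ 2
}.

#[short(type="hilbertType")]
HB.structure Definition Hilbert (R : realType) :=
  { H of CompleteNormedModule R[i] H & CompleteNormedModule_isHilbert R H }.

Arguments inner {R} H : rename.

Definition bounded_operator (R : realType) (H : hilbertType R)
    (T : {linear H -> H}) : Prop :=
  exists M : R, forall x : H, `|T x| <= M%:C * `|x|.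

(* These notions depend on the inner product only, and not on a norm, so that
   they apply both to H and to the direct sum of two copies of H. *)
Section SemiHilbertian.
Context {R : realType} {V : lmodType R[i]}.
Variables (dot : {dot V for @Num.conj R[i]}) (A : {linear V -> V}).
Implicit Types (T : {linear V -> V}) (x y : V).

(* In R[i], 0 <= z means that z is real and nonnegative. *)
Definition positive_operator : Prop := forall x, 0 <= dot (A x) x.

Definition A_inner x y : R[i] := dot (A x) y.

Definition A_norm x : R := Num.sqrt (complex.Re (A_inner x x)).

Definition A_bounded T : Prop :=
  exists c : R, 0 < c /\ forall x, A_norm (T x) <= c * A_norm x.

(* When A = 0, no x satisfies A_norm x = 1 and the suprema below are
   sup set0 = 0. *)
Definition A_opnorm T : R := sup [set A_norm (T x) | x in [set x | A_norm x = 1]].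

(* The norm of R[i] takes its values in R[i], hence the real part. *)
Definition A_numradius T : R :=
  sup [set complex.Re `|A_inner (T x) x| | x in [set x | A_norm x = 1]].

End SemiHilbertian.

Definition in_B_Ahalf (R : realType) (H : hilbertType R)
    (A T : {linear H -> H}) : Prop :=
  bounded_operator T /\ A_bounded (inner H) A T.

Section DirectSumInner.
Context {R : realType} {V : lmodType R[i]}.
Variable dot : {dot V for @Num.conj R[i]}.

Definition dsum_inner (x y : V * V) : R[i] := dot x.1 y.1 + dot x.2 y.2.

Fact dsum_inner_bilinear : bilinear_for *%R (Num.conj \; *%R) dsum_inner.
Proof.
split=> [u' | u] a x y; rewrite /dsum_inner.
  by rewrite !linearDl !linearZl_LR /= mulrDr addrACA.
by rewrite !linearD !linearZ /= mulrDr addrACA.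
Qed.

HB.instance Definition _ :=
  bilinear_isBilinear.Build R[i] (V * V)%type (V * V)%type R[i]
    *%R (Num.conj \; *%R) dsum_inner dsum_inner_bilinear.

Fact dsum_inner_hermitian (x y : V * V) :
  dsum_inner x y = (-1) ^+ false * Num.conj (dsum_inner y x).
Proof.
rewrite expr0 mul1r /dsum_inner rmorphD /=.
by congr (_ + _); rewrite [LHS](hermitian_subproof (s := dot)) expr0 mul1r.
Qed.

HB.instance Definition _ :=
  isHermitianSesquilinear.Build R[i] (V * V)%type false Num.conj
    dsum_inner dsum_inner_hermitian.

Fact dsum_inner_gt0 (u : V * V) : u != 0 -> 0 < dsum_inner u u.
Proof.
case: u => u v; rewrite -[0]/(0, 0) xpair_eqE negb_and /dsum_inner /=.
have ge0 w : 0 <= dot w w.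
  have [->|/(neq0_dnorm_gt0 (s := dot))/ltW//] := eqVneq w 0.
  by rewrite linear0r.
case/orP => /(neq0_dnorm_gt0 (s := dot)) gt0.
  exact: ltr_wpDr (ge0 v) gt0.
exact: ltr_wpDl (ge0 u) gt0.
Qed.

HB.instance Definition _ :=
  isDotProduct.Build R[i] (V * V)%type dsum_inner dsum_inner_gt0.

End DirectSumInner.

Section BlockOperator.
Context {R : realType} {V : lmodType R[i]}.
Variables T11 T12 T21 T22 : {linear V -> V}.

Definition block_op (x : V * V) : V * V :=
  (T11 x.1 + T12 x.2, T21 x.1 + T22 x.2).

Fact block_op_linear : linear block_op.
Proof.
move=> a x y; rewrite /block_op !linearP /= -[RHS]/(_, _) /=.
by rewrite !scalerDr; congr pair; rewrite addrACA.
Qed.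

HB.instance Definition _ :=
  GRing.isLinear.Build R[i] (V * V)%type (V * V)%type *:%R block_op
    block_op_linear.

End BlockOperator.

(* Block-diagonal copies of A induce on V * V the sum of the semi-inner products
   of the summands, and block operators with A-bounded entries are bounded for
   the induced seminorm. *)
Fact A_inner_dsum (R : realType) (V : lmodType R[i])
    (dot : {dot V for @Num.conj R[i]}) (A : {linear V -> V}) (x y : V * V) :
  A_inner (dsum_inner dot) (block_op A \0 \0 A) x y =
    A_inner dot A x.1 y.1 + A_inner dot A x.2 y.2.
Proof.
by rewrite /A_inner /= /dsum_inner /block_op /= addr0 add0r.
Qed.
Fact A_bounded_block (R : realType) (V : lmodType R[i])
    (dot : {dot V for @Num.conj R[i]}) (A T11 T12 T21 T22 : {linear V -> V}) :
  positive_operator dot A ->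
  A_bounded dot A T11 -> A_bounded dot A T12 ->
  A_bounded dot A T21 -> A_bounded dot A T22 ->
  A_bounded (dsum_inner dot) (block_op A \0 \0 A) (block_op T11 T12 T21 T22).
Proof.
move=> posA; pose q x := complex.Re (A_inner dot A x x).
have q_ge0 x : 0 <= q x by have := posA x; rewrite lecE => /andP[].
have qD x y : q (x + y) <= 2 * (q x + q y).
  have := q_ge0 (x - y); rewrite /q /A_inner !linearD !linearN /=.
  rewrite !(linearDl, linearNl) !linearD !linearN /=.
  lra.
have qle c T : 0 < c -> (forall x, A_norm dot A (T x) <= c * A_norm dot A x) ->
    forall x, q (T x) <= c ^+ 2 * q x.
  move=> c0 /[swap] x /(_ x); rewrite /A_norm -/(q _) -/(q _) => h.
  rewrite -{1}(sqr_sqrtr (q_ge0 (T x))) -(sqr_sqrtr (q_ge0 x)) -exprMn.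
  by rewrite ler_sqr ?nnegrE ?mulr_ge0 ?sqrtr_ge0 // ltW.
move=> [c11 [p11 /(qle _ _ p11) h11]] [c12 [p12 /(qle _ _ p12) h12]].
move=> [c21 [p21 /(qle _ _ p21) h21]] [c22 [p22 /(qle _ _ p22) h22]].
pose C := c11 ^+ 2 + c12 ^+ 2 + c21 ^+ 2 + c22 ^+ 2.
have C_gt0 : 0 < C by rewrite /C !addr_gt0 ?exprn_gt0.
exists (Num.sqrt (2 * C)); split; first by rewrite sqrtr_gt0 mulr_gt0.
move=> x; rewrite /A_norm -sqrtrM; last by rewrite mulr_ge0 // ltW.
rewrite ler_wsqrtr //; rewrite !A_inner_dsum !raddfD.
rewrite -!/(q _) /=.
have := qD (T11 x.1) (T12 x.2); have := qD (T21 x.1) (T22 x.2).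
have := h11 x.1; have := h12 x.2; have := h21 x.1; have := h22 x.2.
have := q_ge0 x.1; have := q_ge0 x.2; rewrite /C.
have := sqr_ge0 c11; have := sqr_ge0 c12.
have := sqr_ge0 c21; have := sqr_ge0 c22.
nra.
Qed.

(* Main.v *)
Require Import Defs.
From mathcomp Require Import all_boot all_order all_algebra.
From mathcomp Require Import all_classical all_reals all_analysis.
From mathcomp Require Import sesquilinear complex ring lra.

Import Order.TTheory GRing.Theory Num.Theory.
Import numFieldNormedType.Exports.

Local Open Scope ring_scope.

(** If the image is empty or unbounded, [sup] takes its default value 0; otherwise any element of
    the image is a nonnegative lower bound for it. *)
Lemma sup_image_ge0 (R : realType) (U : Type) (D : set U) (f : U -> R) :
  (forall x, 0 <= f x) -> 0 <= sup (f @` D)%classic.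
Proof.
move=> f0; have [hs|/sup_out->//] := pselect (has_sup (f @` D)%classic).
have [[y [x Dx _]] ub] := hs.
by apply: le_trans (f0 x) _; apply: ub_le_sup => //; exists x.
Qed.

Section SemiInnerProduct.
Context {R : realType} {V : lmodType R[i]}.
Variables (dot : {dot V for @Num.conj R[i]}) (A : {linear V -> V}).
Hypothesis posA : positive_operator dot A.
Implicit Types (T X : {linear V -> V}) (x y : V).

Local Notation B := (A_inner dot A).
Local Notation N := (A_norm dot A).

Lemma A_norm_ge0 x : 0 <= N x.
Proof. exact: sqrtr_ge0. Qed.

Lemma A_norm_sqr x : N x ^+ 2 = complex.Re (B x x).
Proof. by rewrite sqr_sqrtr //; have := posA x; rewrite lecE => /andP[]. Qed.

Lemma A_inner_self_Im x : complex.Im (B x x) = 0.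
Proof. by have := posA x; rewrite lecE => /andP[/eqP]. Qed.

(** [B x y] and [B y x] stay separate because the Hermitian symmetry of [B] is to be derived from
    this expansion. *)
Lemma A_innerDZ (z : R[i]) x y :
  B (x + z *: y) (x + z *: y) =
    B x x + Num.conj z * B x y + (z * B y x + z * Num.conj z * B y y).
Proof.
rewrite /A_inner [A (_ + _)]linearD [A (_ *: _)]linearZ /=.
rewrite !(linearDl, linearD) /=.
by rewrite !linearZl_LR !linearZ.
Qed.

Lemma A_innerZ (k : R) T x :
  B (T (k%:C%C *: x)) (k%:C%C *: x) = (k ^+ 2)%:C%C * B (T x) x.
Proof.
rewrite /A_inner !linearZ /= linearZl_LR /= mulrA.
by congr (_ * _); simpc; rewrite expr2.
Qed.

Lemma A_normZ (k : R) x : 0 <= k -> N (k%:C%C *: x) = k * N x.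
Proof.
move=> k0; apply/eqP; rewrite -(eqrXn2 (n := 2)) ?mulr_ge0 ?A_norm_ge0 //.
rewrite exprMn !A_norm_sqr (A_innerZ k idfun).
by case: (B x x) => a b; rewrite /= mul0r subr0.
Qed.

(* Both the Hermitian symmetry of [B] and the bound come from expanding
   [0 <= B (x + z y) (x + z y)]: symmetry from its imaginary part at [z = 1]
   and [z = i], the bound from its real part at [z = - t B x y], [t] real. *)
Lemma A_inner_CauchySchwarz x y : complex.Re `|B x y| <= N x * N y.
Proof.
rewrite -ler_sqr ?nnegrE ?mulr_ge0 ?A_norm_ge0 ?sqrtr_ge0 //; last first.
  by case: (B x y) => a b; exact: sqrtr_ge0.
rewrite exprMn !A_norm_sqr.
have pos z : 0 <= B x x + Num.conj z * B x y +
    (z * B y x + z * Num.conj z * B y y) by rewrite -A_innerDZ; exact: posA.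
have imx := A_inner_self_Im x; have imy := A_inner_self_Im y.
have := posA x; have := posA y; rewrite -!/(B _ _).
move: pos; move: (B x x) (B y y) (B x y) (B y x) imx imy.
(* In coordinates, [p] and [r] are the real numbers [B x x] and [B y y], while [B x y] is
   [c1 + i c2] and [B y x] is [d1 + i d2]. *)
move=> [p ?] [r ?] [c1 c2] [d1 d2] /= -> -> pos.
rewrite !lecE /= => /andP[_ r0] /andP[_ p0].
have {}pos a b : (a * c2 - b * c1 + a * d2 + b * d1 = 0) /\
    0 <= p + a * c1 + b * c2 + a * d1 - b * d2 + (a ^+ 2 + b ^+ 2) * r.
  have := pos (Complex a b); rewrite lecE /= => /andP[/eqP h1 h2].
  split; first by lra.
  by apply: le_trans h2 _; lra.
have [e1 _] := pos 1 0; have [e2 _] := pos 0 1.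
have [ed1 ed2] : d1 = c1 /\ d2 = - c2 by split; lra.
rewrite sqr_sqrtr ?addr_ge0 ?sqr_ge0 //.
set s := c1 ^+ 2 + c2 ^+ 2.
have s0 : 0 <= s by rewrite addr_ge0 ?sqr_ge0.
have {}pos t : 0 <= p - 2 * t * s + t ^+ 2 * s * r.
  have [_ h] := pos (- t * c1) (- t * c2).
  by apply: le_trans h _; rewrite ed1 ed2 /s; lra.
have [r_eq0|r_neq0] := eqVneq r 0.
  have [->|s_neq0] := eqVneq s 0; first by rewrite mulr_ge0.
  (* For [r = 0] the bound is affine in [t]; this [t] gives [0 <= p - 2 (p + 1)], against
     [0 <= p]. *)
  have := pos ((p + 1) / s); rewrite r_eq0 mulr0 addr0 mulrA divfK //.
  by lra.
(* For [r > 0] the quadratic in [t] is least at [t = 1 / r]. *)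
have := pos r^-1.
have -> : p - 2 * r^-1 * s + r^-1 ^+ 2 * s * r = (p * r - s) / r.
  by field.
by rewrite pmulr_lge0 ?invr_gt0 ?lt_def ?r_neq0 // subr_ge0.
Qed.

Lemma A_norm_neq0_unit x : N x != 0 -> N ((N x)^-1%:C%C *: x) = 1.
Proof. by move=> Nx0; rewrite A_normZ ?invr_ge0 ?A_norm_ge0 // mulVf. Qed.

Lemma A_opnorm_ge0 T : 0 <= A_opnorm dot A T.
Proof. by apply: sup_image_ge0 => x; exact: A_norm_ge0. Qed.

Lemma A_numradius_ge0 T : 0 <= A_numradius dot A T.
Proof.
by apply: sup_image_ge0 => x; case: (B _ _) => a b; exact: sqrtr_ge0.
Qed.

(** [A_bounded] serves twice: it bounds the set whose supremum is taken, and it settles [N x = 0],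
    where [x] cannot be normalised, by forcing [N (T x) = 0]. *)
Lemma A_norm_le_opnorm T x : A_bounded dot A T ->
  N (T x) <= A_opnorm dot A T * N x.
Proof.
move=> [c [c0 bT]]; have [Nx0|Nx0] := eqVneq (N x) 0.
  by have := bT x; rewrite Nx0 !mulr0.
have Nx_gt0 : 0 < N x by rewrite lt_def Nx0 A_norm_ge0.
rewrite -ler_pdivrMr // mulrC -A_normZ ?invr_ge0 ?A_norm_ge0 // -linearZ.
apply: ub_le_sup; last first.
  by exists ((N x)^-1%:C%C *: x) => //; exact: A_norm_neq0_unit.
by exists c => _ [y Ny <-]; have := bT y; rewrite Ny mulr1.
Qed.

(** Both sides scale quadratically in [x], which reduces to [N x = 1]. Cauchy-Schwarz gives the
    bound on the set and makes the left side vanish when [N x = 0]. *)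
Lemma A_inner_le_numradius T x : A_bounded dot A T ->
  complex.Re `|B (T x) x| <= A_numradius dot A T * N x ^+ 2.
Proof.
move=> [c [c0 bT]]; have [Nx0|Nx0] := eqVneq (N x) 0.
  apply: le_trans (A_inner_CauchySchwarz (T x) x) _.
  by rewrite Nx0 expr0n !mulr0.
have Nx_gt0 : 0 < N x ^+ 2 by rewrite exprn_gt0 // lt_def Nx0 A_norm_ge0.
rewrite -ler_pdivrMr //.
have -> : complex.Re `|B (T x) x| / N x ^+ 2 =
    complex.Re `|B (T ((N x)^-1%:C%C *: x)) ((N x)^-1%:C%C *: x)|.
  rewrite A_innerZ normrM ger0_norm ?ler0c ?sqr_ge0 // exprVn mulrC.
  by case: (B _ _) => a b; rewrite /= mul0r subr0.
apply: ub_le_sup; last first.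
  by exists ((N x)^-1%:C%C *: x) => //; exact: A_norm_neq0_unit.
exists c => _ [y Ny <-]; apply: le_trans (A_inner_CauchySchwarz (T y) y) _.
by have := bT y; rewrite Ny !mulr1.
Qed.

(** This estimates the single nonzero row of either block operator: the [T] term is controlled by
    [N x ^+ 2 <= 1], the [X] term by Cauchy-Schwarz and the operator seminorm. *)
Lemma A_inner_add_le T X x y : A_bounded dot A T -> A_bounded dot A X ->
  N x ^+ 2 + N y ^+ 2 = 1 ->
  complex.Re `|B (T x + X y) x| <=
    A_numradius dot A T + 2^-1 * A_opnorm dot A X.
Proof.
move=> bT bX Nxy.
have hT := A_inner_le_numradius T x bT; have hX := A_norm_le_opnorm X y bX.
have w0 := A_numradius_ge0 T; have o0 := A_opnorm_ge0 X.
have tri : complex.Re `|B (T x + X y) x| <=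
    complex.Re `|B (T x) x| + complex.Re `|B (X y) x|.
  have -> : B (T x + X y) x = B (T x) x + B (X y) x.
    by rewrite /A_inner linearD linearDl.
  by have := ler_normD (B (T x) x) (B (X y) x); rewrite lecE => /andP[_].
have cs := A_inner_CauchySchwarz (X y) x.
have x0 := A_norm_ge0 x; have y0 := A_norm_ge0 y.
have h1 : A_numradius dot A T * N x ^+ 2 <= A_numradius dot A T.
  by rewrite ler_piMr //; have := sqr_ge0 (N y); lra.
have h2 : N (X y) * N x <= A_opnorm dot A X * (N y * N x).
  by rewrite mulrA ler_wpM2r.
(* The factor 1/2 arises here: [2 * N x * N y <= N x ^+ 2 + N y ^+ 2 = 1]. *)
have h3 : A_opnorm dot A X * (N y * N x) <= A_opnorm dot A X * 2^-1.
  by apply: ler_wpM2l => //; have := sqr_ge0 (N x - N y); lra.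
lra.
Qed.

Lemma A_norm_dsum_sqr (x : V * V) :
  A_norm (dsum_inner dot) (block_op A \0 \0 A) x ^+ 2 =
    N x.1 ^+ 2 + N x.2 ^+ 2.
Proof.
rewrite /A_norm A_inner_dsum raddfD /= sqr_sqrtr; first by rewrite !A_norm_sqr.
by rewrite -!A_norm_sqr addr_ge0 ?sqr_ge0.
Qed.

Lemma A_numradius_dsum_le (Z : {linear (V * V)%type -> (V * V)%type}) (c : R) :
  0 <= c ->
  (forall x : V * V, N x.1 ^+ 2 + N x.2 ^+ 2 = 1 ->
    complex.Re `|B (Z x).1 x.1 + B (Z x).2 x.2| <= c) ->
  A_numradius (dsum_inner dot) (block_op A \0 \0 A) Z <= c.
Proof.
move=> c0 Zc; rewrite /A_numradius; set E := image _ _.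
(* With no unit vectors (as for [A = 0]) the supremum is 0, and [0 <= c] concludes. *)
have [->|E0] := eqVneq E set0; first by rewrite sup0.
apply: ge_sup; first exact/set0P.
move=> _ [x Nx <-]; rewrite A_inner_dsum; apply: Zc.
by rewrite -A_norm_dsum_sqr Nx expr1n.
Qed.

End SemiInnerProduct.

Theorem corollary2p7 (R : realType) (H : hilbertType R)
    (A T S X Y : {linear H -> H}) :
  bounded_operator A -> positive_operator (inner H) A ->
  in_B_Ahalf A T -> in_B_Ahalf A S -> in_B_Ahalf A X -> in_B_Ahalf A Y ->
  let AA := block_op A \0 \0 A in
  A_numradius (dsum_inner (inner H)) AA (block_op T X \0 \0)
    <= A_numradius (inner H) A T + 2^-1 * A_opnorm (inner H) A X /\
  A_numradius (dsum_inner (inner H)) AA (block_op \0 \0 Y S)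
    <= A_numradius (inner H) A S + 2^-1 * A_opnorm (inner H) A Y.
Proof.
move=> _ posA [_ bT] [_ bS] [_ bX] [_ bY] AA.
have rhs0 (Z W : {linear H -> H}) :
    0 <= A_numradius (inner H) A Z + 2^-1 * A_opnorm (inner H) A W.
  by rewrite addr_ge0 ?mulr_ge0 ?A_numradius_ge0 ?A_opnorm_ge0 ?invr_ge0.
have inner0 x : A_inner (inner H) A 0 x = 0.
  by rewrite /A_inner linear0 linear0l.
split; apply: A_numradius_dsum_le => // -[x1 x2] /= Nx.
  by rewrite addr0 inner0 addr0; exact: A_inner_add_le.
(* In the lower row [S] is the diagonal entry, so [x2] takes the role of [x1] and both sums are
   reordered. *)
rewrite addr0 inner0 add0r [Y x1 + _]addrC.
by apply: A_inner_add_le => //; rewrite addrC.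
Qed.
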